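(* Let $n\ge 0$ and $r\in\mathbb{Z}$. If $D_n^{(r)}\neq 0$, then there exist a monic polynomial $P_n(z;r)$ of degree $n$ satisfying $$\int_{\mathbb{T}} P_n(\zeta;r)\,\zeta^{-2m-r}w(\zeta)\frac{d\zeta}{2\pi i\zeta}=h_n^{(r)}\delta_{mn},\qquad m=0,1,\dots,n,$$ and a monic polynomial $Q_n(z;r)$ of degree $n$ satisfying $$\int_{\mathbb{T}} Q_n(\zeta^{-2};r)\,\zeta^{m-r}w(\zeta)\frac{d\zeta}{2\pi i\zeta}=h_n^{(r)}\delta_{mn},\qquad m=0,1,\dots,n,$$ for a (common) number $h_n^{(r)}$; these polynomials are unique and are given by $$P_n(z;r)=\frac{1}{D_n^{(r)}}\det\begin{pmatrix} w_r & w_{r-1}&\cdots& w_{r-n}\\ w_{r+2}&w_{r+1}&\cdots&w_{r-n+2}\\ \vdots&\vdots&&\vdots\\ w_{r+2n-2}&w_{r+2n-3}&\cdots&w_{r+n-2}\\ 1&z&\cdots&z^n\end{pmatrix},$$ $$Q_n(z;r)=\frac{1}{D_n^{(r)}}\det\begin{pmatrix} w_r & w_{r-1}&\cdots& w_{r-n+1}&1\\ w_{r+2}&w_{r+1}&\cdots&w_{r-n+3}&z\\ \vdots&\vdots&&\vdots&\vdots\\ w_{r+2n}&w_{r+2n-1}&\cdots&w_{r+n+1}&z^n\end{pmatrix}.$$ Moreover $h_n^{(r)}$ exists and equals $$h_n^{(r)}=\frac{D_{n+1}^{(r)}}{D_n^{(r)}}.$$ Consequently, if all $h_\ell^{(r)}$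 exist (in the sense $D_\ell^{(r)}\ne0$) and are non-zero for $\ell=0,\dots,n-1$, then $D_n^{(r)}=\prod_{\ell=0}^{n-1}h_\ell^{(r)}$.
   Context: $\mathbb{T}=\{\zeta\in\mathbb{C}:|\zeta|=1\}$, oriented counterclockwise. $w$ is a complex-valued integrable weight on $\mathbb{T}$ with Fourier coefficients $w_k=\int_{\mathbb{T}}\zeta^{-k}w(\zeta)\frac{d\zeta}{2\pi i\zeta}$, $k\in\mathbb{Z}$. For $n\ge1$ and $r\in\mathbb{Z}$, $D_n^{(r)}=\det(w_{r+2j-k})_{0\le j,k\le n-1}$ ($j$ = row index, $k$ = column index), and $D_0^{(r)}=1$. $\delta_{mn}$ is the Kronecker delta. *)

(* Defs.v *)
From mathcomp Require Import all_boot all_order all_algebra complex.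
From mathcomp Require Import all_classical all_reals all_analysis.

Set Implicit Arguments.
Unset Strict Implicit.
Unset Printing Implicit Defensive.

Import Order.TTheory GRing.Theory Num.Theory.
Import numFieldNormedType.Exports.

Local Open Scope classical_set_scope.
Local Open Scope ring_scope.
Local Open Scope complex_scope.

Section CircleIntegrals.
Variable R : realType.
Implicit Types (f w : R[i] -> R[i]) (g : R -> R[i]).

Local Notation mu := (@lebesgue_measure R).

Definition complex_integrable (D : set R) g : Prop :=
  mu.-integrable D (EFin \o (fun t => complex.Re (g t))) /\
  mu.-integrable D (EFin \o (fun t => complex.Im (g t))).

Definition complex_integral (D : set R) g : R[i] :=
  (\int[mu]_(t in D) complex.Re (g t)) +i* (\int[mu]_(t in D) complex.Im (g t)).

Definition circle_point (t : R) : R[i] := cos t +i* sin t.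

(* A function on the unit circle is represented by a function on R[i] of which
   only the values on the circle matter. *)
Definition circle_integrable f : Prop :=
  complex_integrable `[0, 2 * pi] (fun t => f (circle_point t)).

(* \oint_T f(z) dz, counterclockwise: z = e^(it), dz = i e^(it) dt. *)
Definition contour_integral f : R[i] :=
  complex_integral `[0, 2 * pi]
    (fun t => f (circle_point t) * ('i * circle_point t)).

(* The integral of f(z) dz / (2 pi i z) over the circle. *)
Definition circle_mean f : R[i] :=
  contour_integral (fun z => f z / (2 * pi%:C * 'i * z)).

Definition fourier_coef w (k : int) : R[i] :=
  circle_mean (fun z => z ^ (- k) * w z).

(* The determinant of the empty matrix is 1, so toeplitz_det w r 0 = 1. *)
Definition toeplitz_det w (r : int) (n : nat) : R[i] :=
  \det (\matrix_(j < n, k < n) fourier_coef w (r + 2 * j%:Z - k%:Z)).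

Definition monic_of_degree (n : nat) (P : {poly R[i]}) : Prop :=
  P \is monic /\ size P = n.+1.

Definition P_orthogonal w (r : int) (n : nat) (P : {poly R[i]}) (h : R[i]) :=
  forall m : nat, (m <= n)%N ->
    circle_mean (fun z => P.[z] * z ^ (- 2 * m%:Z - r) * w z)
    = h * (m == n)%:R.

Definition Q_orthogonal w (r : int) (n : nat) (Q : {poly R[i]}) (h : R[i]) :=
  forall m : nat, (m <= n)%N ->
    circle_mean (fun z => Q.[z ^ (- 2)] * z ^ (m%:Z - r) * w z)
    = h * (m == n)%:R.

(* h is a common norming constant h_n^(r) of the two monic families. *)
Definition is_norming_constant w (r : int) (n : nat) (h : R[i]) : Prop :=
  exists P Q : {poly R[i]},
    [/\ monic_of_degree n P, P_orthogonal w r n P h,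
        monic_of_degree n Q & Q_orthogonal w r n Q h].

Definition P_matrix w (r : int) (n : nat) : 'M[{poly R[i]}]_n.+1 :=
  \matrix_(j < n.+1, k < n.+1)
    if (j < n)%N then (fourier_coef w (r + 2 * j%:Z - k%:Z))%:P else 'X^k.

Definition Q_matrix w (r : int) (n : nat) : 'M[{poly R[i]}]_n.+1 :=
  \matrix_(j < n.+1, k < n.+1)
    if (k < n)%N then (fourier_coef w (r + 2 * j%:Z - k%:Z))%:P else 'X^j.

End CircleIntegrals.

(* Main.v *)
(** Write u_{j,k} = w_{r+2j-k}. Linearity of the circle mean turns both
    orthogonality conditions into linear systems for the coefficients: with
    matrix u for P_n, and with its transpose for Q_n. Pairing the bordered
    determinant against the m-th moment row replaces its last row by that row,
    so the value is 0 for m < n (two equal rows) and D_{n+1} for m = n; this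
    handles P_n, and Q_n follows by transposition with the same h_n. The product
    formula telescopes h_l = D_{l+1} / D_l. *)

Require Import Defs.
From mathcomp Require Import all_boot all_order all_algebra complex.
From mathcomp Require Import all_classical all_reals all_analysis.
From mathcomp Require Import ring.

Import Order.TTheory GRing.Theory Num.Theory.
Import numFieldNormedType.Exports.

Local Open Scope ring_scope.
Local Open Scope complex_scope.

(** * Orthogonality against the rows of an abstract moment array *)

Section BorderedDeterminants.
Variables (F : fieldType) (u : nat -> nat -> F).

Definition moment_det (n : nat) : F := \det (\matrix_(j < n, k < n) u j k).

Definition bordered_matrix (n : nat) : 'M[{poly F}]_n.+1 :=
  \matrix_(j < n.+1, k < n.+1) if (j < n)%N then (u j k)%:P else 'X^k.

Definition moment_orthogonal (n : nat) (P : {poly F}) (h : F) :=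
  forall m : nat, (m <= n)%N ->
    \sum_(k < n.+1) P`_k * u m k = h * (m == n)%:R.

(** For [m = n] this is the full moment matrix of order n+1; other values of [m] put a different
    moment row in the place of the row of powers. *)
Definition last_row_replaced (n m : nat) : 'M[F]_n.+1 :=
  \matrix_(j < n.+1, k < n.+1) if (j < n)%N then u j k else u m k.

(** A cofactor along the last row deletes the only row that depends on [m], so [m = n] can serve as
    the representative. *)
Lemma cofactor_last_row_replaced n m k :
  cofactor (last_row_replaced n m) ord_max k =
  cofactor (last_row_replaced n n) ord_max k.
Proof.
rewrite /cofactor; congr (_ * \det _); apply/matrixP => i j.
by rewrite !mxE lift_max ltn_ord.
Qed.

Lemma cofactor_bordered_matrix n k :
  cofactor (bordered_matrix n) ord_max k =
  (cofactor (last_row_replaced n n) ord_max k)%:P.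
Proof.
rewrite /cofactor polyCM polyC_exp polyCN polyC1; congr (_ * _).
rewrite -det_map_mx; congr (\det _); apply/matrixP => i j.
by rewrite !mxE lift_max ltn_ord.
Qed.

(** Laplace expansion along the row of powers: all other rows are constant polynomials, so the
    cofactors are scalars. *)
Lemma det_bordered_matrix n : \det (bordered_matrix n) =
  \sum_(k < n.+1) cofactor (last_row_replaced n n) ord_max k *: 'X^k.
Proof.
rewrite (expand_det_row _ ord_max); apply: eq_bigr => k _.
by rewrite cofactor_bordered_matrix mxE ltnn mulrC mul_polyC.
Qed.

Lemma coef_det_bordered_matrix n (k : 'I_n.+1) :
  (\det (bordered_matrix n))`_k = cofactor (last_row_replaced n n) ord_max k.
Proof.
rewrite det_bordered_matrix coef_sum (bigD1 k) //= coefZ coefXn eqxx mulr1.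
rewrite big1 ?addr0 // => i /negPf ik.
by rewrite coefZ coefXn val_eqE eq_sym ik mulr0.
Qed.

Lemma size_det_bordered_matrix n : (size (\det (bordered_matrix n)) <= n.+1)%N.
Proof.
rewrite det_bordered_matrix; apply: (leq_trans (size_sum _ _ _)).
apply/bigmax_leqP => k _; apply: (leq_trans (size_scale_leq _ _)).
by rewrite size_polyXn ltn_ord.
Qed.

Lemma lead_det_bordered_matrix n :
  (\det (bordered_matrix n))`_n = moment_det n.
Proof.
rewrite (coef_det_bordered_matrix n ord_max).
(* The corner cofactor has sign (-1)^(n + n) = 1, and its minor is the moment matrix of order n. *)
rewrite /cofactor -signr_odd oddD addbb mul1r.
congr (\det _); apply/matrixP => i j.
by rewrite !mxE !lift_max ltn_ord.
Qed.

(** Both sides are one Laplace expansion: the coefficients of the bordered determinant are exactly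
    the cofactors that multiply the replaced row. *)
Lemma last_row_replaced_expansion n m :
  \sum_(k < n.+1) (\det (bordered_matrix n))`_k * u m k =
  \det (last_row_replaced n m).
Proof.
rewrite (expand_det_row (last_row_replaced n m) ord_max); apply: eq_bigr => k _.
by rewrite coef_det_bordered_matrix cofactor_last_row_replaced mxE ltnn mulrC.
Qed.

Lemma det_last_row_replaced n m : (m <= n)%N ->
  \det (last_row_replaced n m) = moment_det n.+1 * (m == n)%:R.
Proof.
rewrite leq_eqVlt => /orP[/eqP ->|mn].
  rewrite eqxx mulr1; congr (\det _); apply/matrixP => j k; rewrite !mxE.
  case: ltnP => // nj; congr (u _ _).
  by apply/eqP; rewrite eqn_leq nj -ltnS ltn_ord.
rewrite (ltn_eqF mn) mulr0.
have i1 : (m < n.+1)%N by rewrite ltnW.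
apply: (@determinant_alternate _ _ _ (Ordinal i1) ord_max).
  by rewrite -val_eqE /= (ltn_eqF mn).
by move=> k; rewrite !mxE /= mn ltnn.
Qed.

Definition moment_poly n : {poly F} :=
  (moment_det n)^-1 *: \det (bordered_matrix n).

Lemma size_moment_poly n : moment_det n != 0 -> size (moment_poly n) = n.+1.
Proof.
move=> D0; rewrite size_scale ?invr_eq0 //.
apply/eqP; rewrite eqn_leq size_det_bordered_matrix /= ltnNge.
(* A smaller size would make the coefficient of index n vanish, and that coefficient is
   [moment_det n]. *)
by apply: contra D0 => /leq_sizeP/(_ _ (leqnn _)) <-;
  rewrite lead_det_bordered_matrix.
Qed.

Lemma moment_poly_monic n : moment_det n != 0 -> moment_poly n \is monic.
Proof.
move=> D0; rewrite monicE lead_coefE size_moment_poly //= coefZ.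
by rewrite lead_det_bordered_matrix mulVf.
Qed.

Lemma moment_poly_orthogonal n :
  moment_orthogonal n (moment_poly n) (moment_det n.+1 / moment_det n).
Proof.
move=> m mn; under eq_bigr do rewrite coefZ -mulrA.
rewrite -mulr_sumr last_row_replaced_expansion det_last_row_replaced //.
by rewrite mulrA [_^-1 * _]mulrC.
Qed.

(* The difference of two solutions has degree less than n, and its coefficient
   vector is killed by the invertible n x n moment matrix. *)
Lemma moment_orthogonal_unique n P h : moment_det n != 0 ->
  P \is monic -> size P = n.+1 -> moment_orthogonal n P h ->
  P = moment_poly n /\ h = moment_det n.+1 / moment_det n.
Proof.
move=> D0 Pm Ps Po; suff PE : P = moment_poly n.
  (* Once P is known, h is read off as its pairing with row n. *)
  split=> //; have := Po n (leqnn _).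
  by rewrite PE (moment_poly_orthogonal n n (leqnn n)) eqxx !mulr1.
pose v : 'cV[F]_n := \col_k (P - moment_poly n)`_k.
have Pn : P`_n = (moment_poly n)`_n.
  have := moment_poly_monic n D0; move: Pm.
  by rewrite !monicE !lead_coefE size_moment_poly // Ps /= => /eqP -> /eqP ->.
have v0 : v = 0.
  have U : (\matrix_(j < n, k < n) u j k) \in unitmx by rewrite unitmxE unitfE.
  rewrite -[v](mulKmx U) [X in _ *m X](_ : _ = 0) ?mulmx0 //.
  apply/matrixP => m j; rewrite !mxE.
  have := moment_poly_orthogonal n m (ltnW (ltn_ord m)).
  have := Po m (ltnW (ltn_ord m)).
  (* Both polynomials are monic, so their terms of index n agree and cancel; a homogeneous system in
     the n lower coefficients remains. *)
  rewrite (ltn_eqF (ltn_ord m)) !mulr0 !big_ord_recr /= Pn => E1 E2.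
  have E := addIr _ (etrans E1 (esym E2)).
  under eq_bigr do rewrite !mxE coefB mulrBr ![u _ _ * _]mulrC.
  by rewrite sumrB E subrr.
apply/polyP => k; case: (ltngtP k n) => [kn|kn|->//].
  have /matrixP/(_ (Ordinal kn) 0) := v0.
  by rewrite !mxE coefB /= => /eqP; rewrite subr_eq0 => /eqP.
by rewrite !nth_default ?Ps ?size_moment_poly.
Qed.

End BorderedDeterminants.
Arguments moment_det {F} u n.
Arguments bordered_matrix {F} u n.
Arguments moment_orthogonal {F} u n P h.
Arguments moment_poly {F} u n.

(** This is why the two families share the same norming constant. *)
Lemma moment_det_tr (F : fieldType) (u : nat -> nat -> F) (n : nat) :
  moment_det (fun j k => u k j) n = moment_det u n.
Proof.
rewrite /moment_det -det_tr; congr (\det _).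
by apply/matrixP => j k; rewrite !mxE.
Qed.

(** * Linearity of the complex integral, through real and imaginary parts *)

Section ComplexIntegral.
Variables (R : realType) (D : set (measurableTypeR R)).
Hypothesis mD : measurable D.
Local Notation mu := (@lebesgue_measure R).
Implicit Types f g : R -> R[i].

Lemma complex_integrableD f g :
  complex_integrable D f -> complex_integrable D g ->
  complex_integrable D (fun t => f t + g t).
Proof.
move=> [fr fi] [gr gi]; split.
  apply: (eq_integrable mD _ _ _ (integrableD mD fr gr)) => // t _ /=.
  by case: (f t) (g t) => [a b] [c d].
apply: (eq_integrable mD _ _ _ (integrableD mD fi gi)) => // t _ /=.
by case: (f t) (g t) => [a b] [c d].
Qed.

Lemma complex_integralD f g :
  complex_integrable D f -> complex_integrable D g ->
  complex_integral D (fun t => f t + g t) =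
  complex_integral D f + complex_integral D g.
Proof.
move=> [fr fi] [gr gi]; rewrite /complex_integral.
transitivity ((\int[mu]_(t in D) (complex.Re (f t) + complex.Re (g t)))
  +i* (\int[mu]_(t in D) (complex.Im (f t) + complex.Im (g t)))).
  by congr (_ +i* _); apply: eq_Rintegral => t _;
    case: (f t) (g t) => [a b] [c d].
by rewrite !RintegralD.
Qed.

(** Each component of the product is a combination of bounded measurable functions times integrable
    ones. The multiplier is given by its components so that it matches [circle_point] and its
    inverse. *)
Lemma complex_integrableM (a b : measurableTypeR R -> R) g :
  measurable_fun D a -> [bounded a t | t in D] ->
  measurable_fun D b -> [bounded b t | t in D] ->
  complex_integrable D g ->
  complex_integrable D (fun t => (a t +i* b t) * g t).
Proof.
move=> ma ba mb bb [gr gi]; split.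
  apply: (eq_integrable mD _ _ _ (integrableB mD (integrableMr mD ma ba gr)
    (integrableMr mD mb bb gi))) => // t _ /=.
  by case: (g t).
apply: (eq_integrable mD _ _ _ (integrableD mD (integrableMr mD ma ba gi)
  (integrableMr mD mb bb gr))) => // t _ /=.
by case: (g t).
Qed.

Lemma complex_integrableZl c g :
  complex_integrable D g -> complex_integrable D (fun t => c * g t).
Proof.
move=> [gr gi]; case: c => a b; split.
  apply: (eq_integrable mD _ _ _ (integrableB mD (integrableZl mD a gr)
    (integrableZl mD b gi))) => // t _ /=.
  by case: (g t).
apply: (eq_integrable mD _ _ _ (integrableD mD (integrableZl mD a gi)
  (integrableZl mD b gr))) => // t _ /=.
by case: (g t).
Qed.

Lemma complex_integralZl c g : complex_integrable D g ->
  complex_integral D (fun t => c * g t) = c * complex_integral D g.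
Proof.
move=> [gr gi]; case: c => a b; rewrite /complex_integral.
have Zr k : mu.-integrable D (EFin \o (fun t => k * complex.Re (g t))).
  by apply: (eq_integrable mD _ _ _ (integrableZl mD k gr)).
have Zi k : mu.-integrable D (EFin \o (fun t => k * complex.Im (g t))).
  by apply: (eq_integrable mD _ _ _ (integrableZl mD k gi)).
transitivity
  ((\int[mu]_(t in D) (a * complex.Re (g t) - b * complex.Im (g t)))
   +i* (\int[mu]_(t in D) (a * complex.Im (g t) + b * complex.Re (g t)))).
  by congr (_ +i* _); apply: eq_Rintegral => t _; case: (g t).
by rewrite RintegralB // RintegralD // !RintegralZl.
Qed.

Lemma complex_integral0 : complex_integral D (fun=> 0) = 0.
Proof. by rewrite /complex_integral /Rintegral /= integral0. Qed.

Lemma complex_integrable0 : complex_integrable D (fun=> 0).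
Proof. by split; apply: integrable0. Qed.

Lemma complex_integrable_sum n (F : nat -> R -> R[i]) :
  (forall k, complex_integrable D (F k)) ->
  complex_integrable D (fun t => \sum_(k < n) F k t).
Proof.
move=> iF; elim: n => [|n IHn].
  by under eq_fun do rewrite big_ord0; exact: complex_integrable0.
by under eq_fun do rewrite big_ord_recr /=; exact: complex_integrableD.
Qed.

Lemma complex_integral_sum n (F : nat -> R -> R[i]) :
  (forall k, complex_integrable D (F k)) ->
  complex_integral D (fun t => \sum_(k < n) F k t) =
  \sum_(k < n) complex_integral D (F k).
Proof.
move=> iF; elim: n => [|n IHn].
  by under eq_fun do rewrite big_ord0; rewrite big_ord0 complex_integral0.
under eq_fun do rewrite big_ord_recr /=.
rewrite complex_integralD ?IHn ?big_ord_recr //.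
exact: complex_integrable_sum.
Qed.

End ComplexIntegral.

(** * Circle means of Laurent polynomials against the weight *)

Section CircleMean.
Variable R : realType.
Implicit Types (f w : R[i] -> R[i]) (t : R).

(** On the unit circle the inverse is the conjugate. *)
Lemma circle_point_inv t : (circle_point t)^-1 = cos t +i* - sin t.
Proof.
by rewrite /circle_point; rewrite /GRing.inv /= cos2Dsin2 !divr1.
Qed.

Lemma circle_point_neq0 t : circle_point t != 0.
Proof.
apply/eqP => -[c0 s0]; have := cos2Dsin2 t.
by rewrite c0 s0 expr0n addr0 => /eqP; rewrite eq_sym oner_eq0.
Qed.

(** Induction on the absolute value of the exponent: each step multiplies by z or its inverse, whose
    components are continuous and bounded by 1. *)
Lemma circle_integrable_exprz f (e : int) :
  circle_integrable f -> circle_integrable (fun z => z ^ e * f z).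
Proof.
have mI : measurable (`[0, 2 * pi]%classic : set (measurableTypeR R)) by [].
have mc : measurable_fun (`[0, 2 * pi]%classic : set (measurableTypeR R))
  (@cos R).
  apply: measurable_funTS.
  apply: measurable_realfun.continuous_measurable_fun; exact: continuous_cos.
have ms : measurable_fun (`[0, 2 * pi]%classic : set (measurableTypeR R))
  (@sin R).
  apply: measurable_funTS.
  apply: measurable_realfun.continuous_measurable_fun; exact: continuous_sin.
have bc : [bounded (@cos R) t | t in `[0, 2 * (pi : R)]%classic].
  by exists 1; split=> // x x1 t _ /=; exact: le_trans (cos_max t) (ltW x1).
have bs : [bounded (@sin R) t | t in `[0, 2 * (pi : R)]%classic].
  by exists 1; split=> // x x1 t _ /=; exact: le_trans (sin_max t) (ltW x1).
have bNs : [bounded (- sin t : R) | t in `[0, 2 * (pi : R)]%classic].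
  exists 1; split=> // x x1 t _ /=; rewrite normrN.
  exact: le_trans (sin_max t) (ltW x1).
rewrite /circle_integrable => fi.
rewrite -[X in complex_integrable _ X]/(fun t =>
  circle_point t ^ e * f (circle_point t)).
case: e => n; rewrite ?NegzE.
  elim: n => [|n IHn]; first by under [X in complex_integrable _ X]eq_fun do
    rewrite -exprnP expr0 mul1r.
  under [X in complex_integrable _ X]eq_fun do rewrite -exprnP exprS -mulrA.
  exact: complex_integrableM IHn.
(* A negative exponent has the form -(n+1), so the base case is already one factor of the
   inverse. *)
elim: n => [|n IHn].
  under [X in complex_integrable _ X]eq_fun do
    rewrite -exprnN expr1 circle_point_inv.
  apply: complex_integrableM => //; exact: measurableT_comp.
under [X in complex_integrable _ X]eq_fun do
  rewrite -exprnN exprS invfM circle_point_inv -mulrA.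
apply: complex_integrableM => //; exact: measurableT_comp.
Qed.

(** The factor iz from dz = iz dt cancels against the denominator 2 pi i z, leaving dt / (2 pi). *)
Lemma circle_meanE f : circle_mean f =
  complex_integral `[0, 2 * pi]%classic
    (fun t => f (circle_point t) / (2 * pi%:C)).
Proof.
rewrite /circle_mean /contour_integral; congr complex_integral.
apply/funext => t; rewrite -mulrA; congr (_ * _).
have i0 : 'i != 0 :> R[i] := neq0Ci _.
rewrite -[X in X^-1]mulrA invfM -mulrA mulVf ?mulr1 //.
by rewrite mulf_neq0 // circle_point_neq0.
Qed.

(** Restricting to the circle keeps z nonzero, as the laws for integer powers require. *)
Lemma circle_mean_eq f g :
  (forall t, f (circle_point t) = g (circle_point t)) ->
  circle_mean f = circle_mean g.
Proof.
by move=> fg; rewrite !circle_meanE; under [X in complex_integral _ X]eq_fun do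
  rewrite fg.
Qed.

Lemma circle_mean_sum w n (c : nat -> R[i]) (e : nat -> int) :
  circle_integrable w ->
  circle_mean (fun z => (\sum_(k < n) c k * z ^ e k) * w z) =
  \sum_(k < n) c k * circle_mean (fun z => z ^ e k * w z).
Proof.
move=> wi; rewrite circle_meanE.
have mI : measurable (`[0, 2 * pi]%classic : set (measurableTypeR R)) by [].
pose F k t := c k *
  ((2 * pi%:C)^-1 * (circle_point t ^ e k * w (circle_point t))).
have iF k : complex_integrable `[0, 2 * pi]%classic (F k).
  do 2!apply: complex_integrableZl => //.
  exact: (@circle_integrable_exprz w (e k)).
transitivity (complex_integral `[0, 2 * pi]%classic
  (fun t => \sum_(k < n) F k t)).
  congr complex_integral; apply/funext => t.
  rewrite -mulrA mulr_suml; apply: eq_bigr => k _.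
  by rewrite /F -mulrA; congr (_ * _); rewrite mulrA mulrC.
rewrite complex_integral_sum //; apply: eq_bigr => k _.
rewrite complex_integralZl //; last first.
  apply: complex_integrableZl => //.
  exact: (@circle_integrable_exprz w (e k)).
by rewrite circle_meanE; under [X in complex_integral _ X]eq_fun do
  rewrite mulrC.
Qed.

(** The exponents combine as k - 2m - r = -(r + 2m - k), so the coefficient index of P is the column
    index of the moments. *)
Lemma circle_mean_P w (r : int) n (P : {poly R[i]}) (m : nat) :
  circle_integrable w -> size P = n.+1 ->
  circle_mean (fun z => P.[z] * z ^ (- 2 * m%:Z - r) * w z) =
  \sum_(k < n.+1) P`_k * fourier_coef w (r + 2 * m%:Z - k%:Z).
Proof.
move=> wi sP; rewrite -(circle_mean_sum w n.+1 (fun k => P`_k)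
  (fun k => - (r + 2 * m%:Z - k%:Z))) //.
apply: circle_mean_eq => t; congr (_ * _).
rewrite horner_coef sP mulr_suml; apply: eq_bigr => k _.
rewrite -mulrA exprnP -expfzDr ?circle_point_neq0 //.
by congr (_ * _ ^ _); ring.
Qed.

(** Here -2j + m - r = -(r + 2j - m): the coefficient index of Q is the row index, whence the
    transposed array. *)
Lemma circle_mean_Q w (r : int) n (Q : {poly R[i]}) (m : nat) :
  circle_integrable w -> size Q = n.+1 ->
  circle_mean (fun z => Q.[z ^ (- 2)] * z ^ (m%:Z - r) * w z) =
  \sum_(j < n.+1) Q`_j * fourier_coef w (r + 2 * j%:Z - m%:Z).
Proof.
move=> wi sQ; rewrite -(circle_mean_sum w n.+1 (fun j => Q`_j)
  (fun j => - (r + 2 * j%:Z - m%:Z))) //.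
apply: circle_mean_eq => t; congr (_ * _).
rewrite horner_coef sQ mulr_suml; apply: eq_bigr => k _.
rewrite -mulrA exprnP exprz_exp -expfzDr ?circle_point_neq0 //.
by congr (_ * _ ^ _); ring.
Qed.

End CircleMean.

(** * Transfer to the Toeplitz determinants of the weight *)

Section Biorthogonality.
Variables (R : realType) (w : R[i] -> R[i]) (r : int).
Hypothesis w_int : circle_integrable w.
Implicit Types (n : nat) (h : R[i]) (P Q : {poly R[i]}).

Let u (j k : nat) : R[i] := fourier_coef w (r + 2 * j%:Z - k%:Z).
Let v (j k : nat) : R[i] := u k j.

Lemma toeplitz_det_trE n : toeplitz_det w r n = moment_det v n.
Proof. by rewrite /v moment_det_tr. Qed.

Lemma det_P_matrix n :
  (toeplitz_det w r n)^-1 *: \det (P_matrix w r n) = moment_poly u n.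
Proof. by []. Qed.

(** The powers border the last column of [Q_matrix], so it is the transpose of the bordered matrix
    of [v]. *)
Lemma det_Q_matrix n :
  (toeplitz_det w r n)^-1 *: \det (Q_matrix w r n) = moment_poly v n.
Proof.
rewrite toeplitz_det_trE /moment_poly -det_tr.
by congr (_ *: \det _); apply/matrixP => j k; rewrite !mxE.
Qed.

Lemma P_orthogonalE n P h : size P = n.+1 ->
  P_orthogonal w r n P h <-> moment_orthogonal u n P h.
Proof.
move=> sP; split=> oP m mn; have := oP m mn.
  by rewrite (circle_mean_P _ _ _ _ _ _ w_int sP).
by rewrite (circle_mean_P _ _ _ _ _ _ w_int sP).
Qed.

Lemma Q_orthogonalE n Q h : size Q = n.+1 ->
  Q_orthogonal w r n Q h <-> moment_orthogonal v n Q h.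
Proof.
move=> sQ; split=> oQ m mn; have := oQ m mn.
  by rewrite (circle_mean_Q _ _ _ _ _ _ w_int sQ).
by rewrite (circle_mean_Q _ _ _ _ _ _ w_int sQ).
Qed.

Lemma P_orthogonal_unique n P h : toeplitz_det w r n != 0 ->
  monic_of_degree n P -> P_orthogonal w r n P h ->
  P = moment_poly u n /\ h = toeplitz_det w r n.+1 / toeplitz_det w r n.
Proof.
move=> D0 [mP sP] /(P_orthogonalE _ _ _ sP).
exact: moment_orthogonal_unique.
Qed.

Lemma Q_orthogonal_unique n Q h : toeplitz_det w r n != 0 ->
  monic_of_degree n Q -> Q_orthogonal w r n Q h ->
  Q = moment_poly v n /\ h = toeplitz_det w r n.+1 / toeplitz_det w r n.
Proof.
rewrite !toeplitz_det_trE => D0 [mQ sQ] /(Q_orthogonalE _ _ _ sQ).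
exact: moment_orthogonal_unique.
Qed.

Lemma P_poly_orthogonal n : toeplitz_det w r n != 0 ->
  monic_of_degree n (moment_poly u n) /\
  P_orthogonal w r n (moment_poly u n)
    (toeplitz_det w r n.+1 / toeplitz_det w r n).
Proof.
move=> D0; have s := size_moment_poly _ u _ D0.
split; first by split=> //; exact: moment_poly_monic.
by apply/P_orthogonalE => //; exact: moment_poly_orthogonal.
Qed.

Lemma Q_poly_orthogonal n : toeplitz_det w r n != 0 ->
  monic_of_degree n (moment_poly v n) /\
  Q_orthogonal w r n (moment_poly v n)
    (toeplitz_det w r n.+1 / toeplitz_det w r n).
Proof.
rewrite !toeplitz_det_trE => D0; have s := size_moment_poly _ v _ D0.
split; first by split=> //; exact: moment_poly_monic.
by apply/Q_orthogonalE => //; exact: moment_poly_orthogonal.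
Qed.

Lemma toeplitz_det_prod n (h : nat -> R[i]) :
  (forall l, (l < n)%N ->
    toeplitz_det w r l != 0 /\ is_norming_constant w r l (h l)) ->
  toeplitz_det w r n = \prod_(0 <= l < n) h l.
Proof.
elim: n => [|n IHn] hP; first by rewrite big_nil /toeplitz_det det_mx00.
rewrite big_nat_recr //= -IHn; last by move=> l ln; exact/hP/ltnW.
have [D0 [P [Q [mP oP _ _]]]] := hP n (leqnn _).
(* Uniqueness pins the given constant to D_{n+1} / D_n, and D_n then cancels. *)
have [_ ->] := P_orthogonal_unique _ _ _ D0 mP oP.
by rewrite mulrC divfK.
Qed.

End Biorthogonality.

Theorem theorem3p1 (R : realType) (w : R[i] -> R[i]) (n : nat) (r : int)
    (w_int : circle_integrable w) :
  (toeplitz_det w r n != 0 ->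
    exists (P Q : {poly R[i]}) (h : R[i]),
      [/\ [/\ monic_of_degree n P, P_orthogonal w r n P h,
              monic_of_degree n Q & Q_orthogonal w r n Q h],
          forall (P' : {poly R[i]}) (h' : R[i]),
            monic_of_degree n P' -> P_orthogonal w r n P' h' ->
            P' = P /\ h' = h,
          forall (Q' : {poly R[i]}) (h' : R[i]),
            monic_of_degree n Q' -> Q_orthogonal w r n Q' h' ->
            Q' = Q /\ h' = h,
          P = (toeplitz_det w r n)^-1 *: \det (P_matrix w r n) /\
          Q = (toeplitz_det w r n)^-1 *: \det (Q_matrix w r n)
        & h = toeplitz_det w r n.+1 / toeplitz_det w r n]) /\
  (forall h : nat -> R[i],
    (forall l : nat, (l < n)%N ->
      [/\ toeplitz_det w r l != 0, is_norming_constant w r l (h l)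
        & h l != 0]) ->
    toeplitz_det w r n = \prod_(0 <= l < n) h l).
Proof.
split=> [D0|h hP]; last first.
  by apply: (toeplitz_det_prod R w r w_int) => l /hP[].
have [mP oP] := P_poly_orthogonal R w r w_int n D0.
have [mQ oQ] := Q_poly_orthogonal R w r w_int n D0.
(* The abstract solutions are exchanged for the explicit determinants, which serve as witnesses. *)
rewrite -det_P_matrix in mP oP; rewrite -det_Q_matrix in mQ oQ.
exists ((toeplitz_det w r n)^-1 *: \det (P_matrix w r n)),
  ((toeplitz_det w r n)^-1 *: \det (Q_matrix w r n)),
  (toeplitz_det w r n.+1 / toeplitz_det w r n); split=> // [P|Q] h m o.
  by rewrite det_P_matrix; exact: P_orthogonal_unique m o.
by rewrite det_Q_matrix; exact: Q_orthogonal_unique m o.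
Qed.
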